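(* Let $1\le r\le n$ and let $(\mathbf X^s,\mathbf U^s)$ be a stationary pair of stochastic processes, with $\varrho^s_X$ the law of $X^s(k)$. Assume the stochastic optimal control problem has the $L^r$ turnpike property with respect to $(\mathbf X^s,\mathbf U^s)$. Then it has the Wasserstein turnpike property of order $s$ with respect to $(\mathbf X^s,\mathbf U^s)$ for all $1\le s\le r$, i.e. the distributional turnpike property with $d_D$ the Wasserstein distance of order $s$.
   Context: Setting. $\mathcal X,\mathcal U,\mathcal W$ are separable Banach spaces, $\|\cdot\|$ is the norm of $\mathcal X$, $(\Omega,\mathcal F,\mathbb P)$ is a probability space, $n,l\ge 1$ are fixed exponents, and $L^n(\Omega,\mathcal F,\mathbb P;\mathcal X)$ is the space of $\mathcal X$-valued random variables with finite $n$-th moment. $f:\mathcal X\times\mathcal U\times\mathcal W\to\mathcal X$ is continuous in $(x,u)$ for almost all $w$. $\mathbf W=(W(0),W(1),\dots)$ is a fixed i.i.d. sequence with distribution $\varrho_W$. The control system is $X(k+1)=f(X(k),U(k),W(k))$, $X(0)=X_0$, with $X(k)\in L^n(\Omega,\mathcal F_k,\mathbb P;\mathcal X)$, $U(k)\in L^l(\Omega,\mathcal F_k,\mathbb P;\mathcal U)$, $\mathcal F_k=\sigma(X(0),\dots,X(k))$; it is always required that $W(k)$ is independent of $(X(k),U(k))$. The trajectory is denoted $X_{\mathbf U}(k,X_0)$ or $X(k)$. The constraint set $\mathbb Y\subseteq L^n(\Omega,\mathcal F,\mathbb P;\mathcal X)\times L^l(\Omega,\mathcal F,\mathbb P;\mathcal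 U)$ is law-invariant (if $(X,U)\in\mathbb Y$ and $(Y,V)$ has the same joint law as $(X,U)$, then $(Y,V)\in\mathbb Y$); $\mathbb X:=\{X : \exists U,\ (X,U)\in\mathbb Y\}$. $\mathbb U^N(X_0)$ is the set of admissible control sequences $\mathbf U=(U(0),\dots,U(N-1))$ for $X_0\in\mathbb X$: $U(k)\in L^l(\Omega,\mathcal F_k,\mathbb P;\mathcal U)$, $(X(k),U(k))\in\mathbb Y$ for $k=0,\dots,N-1$, and $X(N)\in\mathbb X$; $\mathbb U^\infty(X_0)$ is defined analogously for infinite sequences ($(X(k),U(k))\in\mathbb Y$ for all $k\in\mathbb N_0$). It is assumed that $\mathbb U^\infty(X_0)\ne\emptyset$ for all $X_0\in\mathbb X$. The stage cost $\ell:\mathbb Y\to\mathbb R$ is law-invariant ($\ell(X,U)$ depends only on the joint law of $(X,U)$). Markov policies. $\Pi_0(\mathcal X,\mathcal U)$ is the set of (measurable) maps $\pi:\mathcal X\to\mathcal U$ with $\pi\circ X\in L^l(\Omega,\mathcal F,\mathbb P;\mathcal U)$ for all $X\in L^n(\Omega,\mathcal F,\mathbb P;\mathcal X)$. $\mathbb F^N(X_0)$ (for $N\in\mathbb N\cup\{\infty\}$) is the set of $\mathbf U\in\mathbb U^N(X_0)$ such that for every $k<N$ there is $\pi_k\in\Pi_0(\mathcal X,\mathcal U)$ with $U(k)=\pi_k(X(k))$. The stochastic optimal control problem is to minimize $J_N(X_0,\mathbf U)=\sum_{k=0}^{N-1}\ell(X(k),U(k))$ over $\mathbf U\in\mathbb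 F^N(X_0)$. Stationary pair. $(\mathbf X^s,\mathbf U^s)$ with $X^s(k+1)=f(X^s(k),U^s(k),W(k))$ (same noise $\mathbf W$), $\mathbf U^s\in\mathbb F^\infty(X^s(0))$, is stationary if the laws of $X^s(k)$, of $U^s(k)$ and of $(X^s(k),U^s(k))$ do not depend on $k\in\mathbb N_0$. Then $\ell(\mathbf X^s,\mathbf U^s)$ denotes the $k$-independent value $\ell(X^s(k),U^s(k))$. $\mathcal K_\infty$ is the set of continuous, strictly increasing, unbounded $\alpha:[0,\infty)\to[0,\infty)$ with $\alpha(0)=0$. $P_X$ denotes the law of $X$; $\mathcal P_n(\mathcal X)$ is the set of Borel probability measures on $\mathcal X$ with finite $n$-th moment. $L^r$ turnpike property: there exists $\alpha_1\in\mathcal K_\infty$ such that for each $X_0\in\mathbb X$ there is $C_a>0$ such that for each $\delta>0$, $N\in\mathbb N$, each $\mathbf U\in\mathbb F^N(X_0)$ with $J_N(X_0,\mathbf U)\le\delta+N\ell(\mathbf X^s,\mathbf U^s)$ and each $\varepsilon>0$, $$\#\{k\in\{0,\dots,N\} : \mathbb E[\|X_{\mathbf U}(k,X_0)-X^s(k)\|^r]\le\varepsilon\}\ \ge\ N-\frac{\delta+C_a}{\alpha_1(\varepsilon)}.$$ Distributional turnpike property with respect to a metric $d_D$ on $\mathcal P_n(\mathcal X)$: there exists $\alpha_3\in\mathcal K_\infty$ such that for each $X_0\in\mathbb X$ there is $C_c>0$ such that for each $\delta>0$, $N\in\mathbb N$, each $\mathbf U\in\mathbb F^N(X_0)$ with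 $J_N(X_0,\mathbf U)\le\delta+N\ell(\mathbf X^s,\mathbf U^s)$ and each $\varepsilon>0$, $$\#\{k\in\{0,\dots,N\} : d_D(P_{X_{\mathbf U}(k,X_0)},\varrho^s_X)\le\varepsilon\}\ \ge\ N-\frac{\delta+C_c}{\alpha_3(\varepsilon)}.$$ Wasserstein distance of order $s$: $d_{W_s}(P_X,P_Y)=\inf\{(\mathbb E[\|\bar X-\bar Y\|^s])^{1/s}:\bar X\sim P_X,\ \bar Y\sim P_Y\}$ (infimum over all couplings). *)

(* Defs.v *)
(* Random variables are everywhere defined functions on the sample space, not
   classes modulo almost sure equality; measurability and moments are imposed
   by predicates. *)
From HB Require Import structures.
From mathcomp Require Import all_boot all_order all_algebra.
From mathcomp Require Import all_classical all_reals all_analysis.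
Set Implicit Arguments.
Unset Strict Implicit.
Unset Printing Implicit Defensive.
Import Order.TTheory GRing.Theory Num.Theory.
Import numFieldNormedType.Exports.
Local Open Scope classical_set_scope.
Local Open Scope ring_scope.

Notation borel V := (g_sigma_algebraType (@open V)).

Definition separable (T : topologicalType) : Prop :=
  exists2 D : set T, countable D & dense D.

Section probability_notions.
Context {R : realType} {d : measure_display} {Omega : measurableType d}.
Variable P : probability Omega R.

(* The image measure of X. The default value of insubd makes this a total
   function returning a probability measure; see lawE. *)
Definition law {d'} {T : measurableType d'} (X : Omega -> T) :
    probability T R :=
  distribution P (insubd (cst point : {mfun Omega >-> T}) X).

Lemma lawE {d'} {T : measurableType d'} (X : Omega -> T) (A : set T) :
  measurable_fun setT X -> law X A = P (X @^-1` A).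
Proof.
move=> mX; have XP : X \in @mfun _ _ Omega T by exact: mem_set.
change (P (val (insubd (cst point : {mfun Omega >-> T}) X) @^-1` A) =
        P (X @^-1` A)).
by rewrite insubdK.
Qed.

Definition eq_on_measurable {d'} {T : measurableType d'}
    (mu nu : probability T R) : Prop :=
  forall A, measurable A -> mu A = nu A.

Definition independent2 {d1 d2} {T1 : measurableType d1}
    {T2 : measurableType d2} (X : Omega -> T1) (Y : Omega -> T2) : Prop :=
  forall A B, measurable A -> measurable B ->
    P (X @^-1` A `&` Y @^-1` B) = (P (X @^-1` A) * P (Y @^-1` B))%E.

Definition mutually_independent {d'} {T : measurableType d'}
    (X : nat -> Omega -> T) : Prop :=
  forall (s : seq nat) (A : nat -> set T), uniq s ->
    (forall k, measurable (A k)) ->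
    P (\bigcap_(k in [set` s]) (X k @^-1` A k)) =
    (\prod_(k <- s) P (X k @^-1` A k))%E.

Definition iid {d'} {T : measurableType d'} (X : nat -> Omega -> T)
    (rho : probability T R) : Prop :=
  [/\ forall k, measurable_fun setT (X k),
      forall k, eq_on_measurable (law (X k)) rho
    & mutually_independent X].

Section vector_valued.
Variable V : completeNormedModType R.

Definition is_random_variable (X : Omega -> V) : Prop :=
  measurable_fun setT (X : Omega -> borel V).

(* L^q (Omega, G, P; V) for a sub-sigma-algebra G *)
Definition Lq (q : R) (G : set (set Omega)) : set (Omega -> V) :=
  [set X | (forall A : set (borel V), measurable A -> G (X @^-1` A)) /\
           ('E_P[fun w => (`|X w| `^ q)%R] < +oo)%E].

(* sigma(X(0), ..., X(k)) *)
Definition natural_filtration (X : nat -> Omega -> V) (k : nat) :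
    set (set Omega) :=
  <<s \bigcup_(j in `I_k.+1)
        preimage_set_system setT (X j : Omega -> borel V) measurable >>.

End vector_valued.

Definition joint {V U : completeNormedModType R} (X : Omega -> V)
    (Y : Omega -> U) : Omega -> borel V * borel U := fun w => (X w, Y w).

End probability_notions.

Section wasserstein_distance.
Context {R : realType} {V : completeNormedModType R}.

(* The random variables Xb and Yb range over all probability spaces, so that
   their joint law ranges over all couplings of mu and nu. The value is finite
   when mu and nu have finite s-th moments. *)
Definition wasserstein (s : R) (mu nu : probability (borel V) R) : \bar R :=
  ereal_inf [set c | exists (d : measure_display) (Omega : measurableType d)
      (P : probability Omega R) (Xb Yb : Omega -> V),
    [/\ is_random_variable Xb, is_random_variable Yb,
        eq_on_measurable (law P (Xb : Omega -> borel V)) mu,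
        eq_on_measurable (law P (Yb : Omega -> borel V)) nu
      & c = ('E_P[fun w => (`|Xb w - Yb w| `^ s)%R] `^ s^-1)%E]].

End wasserstein_distance.

(* Only the values on [0, +oo[ matter. *)
Definition class_Kinfty {R : realType} (alpha : R -> R) : Prop :=
  [/\ {within `[0, +oo[, continuous alpha},
      {in `[0, +oo[ &, {homo alpha : x y / x < y}},
      alpha 0 = 0
    & forall M, exists2 x, 0 <= x & M < alpha x].

Section control.
Context {R : realType} {VX VU VW : completeNormedModType R}.
Context {d : measure_display} {Omega : measurableType d}.
Variables (P : probability Omega R) (n l : R).
Variables (f : VX -> VU -> VW -> VX) (W : nat -> Omega -> VW).
Variable YY : set ((Omega -> VX) * (Omega -> VU)).
Variable ell : (Omega -> VX) * (Omega -> VU) -> R.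

Definition law_invariant_set : Prop :=
  forall X U Y V, YY (X, U) -> is_random_variable Y -> is_random_variable V ->
    eq_on_measurable (law P (joint Y V)) (law P (joint X U)) -> YY (Y, V).

(* ell is a function on YY: its values elsewhere are irrelevant. *)
Definition law_invariant_cost : Prop :=
  forall X U Y V, YY (X, U) -> YY (Y, V) ->
    eq_on_measurable (law P (joint Y V)) (law P (joint X U)) ->
    ell (Y, V) = ell (X, U).

Definition state_constraint : set (Omega -> VX) :=
  [set X | exists U, YY (X, U)].

Fixpoint trajectory (U : nat -> Omega -> VU) (X0 : Omega -> VX) (k : nat) :
    Omega -> VX :=
  if k is k'.+1 then fun w => f (trajectory U X0 k' w) (U k' w) (W k' w)
  else X0.

(* X0 is independent of the whole noise sequence W. *)
Definition independent_of_noise (X0 : Omega -> VX) : Prop :=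
  forall (s : seq nat) (A : set (borel VX)) (B : nat -> set (borel VW)),
    measurable A -> (forall k, measurable (B k)) ->
    P (X0 @^-1` A `&` \bigcap_(k in [set` s]) (W k @^-1` B k)) =
    (P (X0 @^-1` A) * P (\bigcap_(k in [set` s]) (W k @^-1` B k)))%E.

(* The last clause is the standing requirement that W(k) be independent of
   (X(k), U(k)). *)
Definition admissible_at (X0 : Omega -> VX) (U : nat -> Omega -> VU)
    (k : nat) : Prop :=
  [/\ Lq P l (natural_filtration (trajectory U X0) k) (U k),
      YY (trajectory U X0 k, U k)
    & independent2 P (W k : Omega -> borel VW)
        (joint (trajectory U X0 k) (U k))].

(* A control sequence of length N is given by the first N terms of an infinite
   sequence; the other terms are unconstrained and never used. *)
Definition admissible (N : nat) (X0 : Omega -> VX) :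
    set (nat -> Omega -> VU) :=
  [set U | (forall k, (k < N)%N -> admissible_at X0 U k) /\
           state_constraint (trajectory U X0 N)].

Definition admissible_infty (X0 : Omega -> VX) : set (nat -> Omega -> VU) :=
  [set U | forall k, admissible_at X0 U k].

(* The state constraint set being law-invariant, it also contains, in general,
   states X0 that are correlated with the noise, from which the requirement on
   W(0) cannot hold for any control. Existence of admissible controls is
   therefore only asked for initial states independent of the noise. *)
Definition feasible : Prop :=
  forall X0, state_constraint X0 -> independent_of_noise X0 ->
    exists U, admissible_infty X0 U.

(* Pi_0 *)
Definition policy : set (VX -> VU) :=
  [set pi | measurable_fun setT (pi : borel VX -> borel VU) /\
            forall X : Omega -> VX, Lq P n measurable X ->
              Lq P l measurable (pi \o X)].

Definition markov_at (X0 : Omega -> VX) (U : nat -> Omega -> VU)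
    (k : nat) : Prop :=
  exists2 pi, policy pi & U k = pi \o trajectory U X0 k.

(* F^N(X0) and F^infty(X0) *)
Definition markov_controls (N : nat) (X0 : Omega -> VX) : set (nat -> Omega -> VU) :=
  [set U | admissible N X0 U /\ forall k, (k < N)%N -> markov_at X0 U k].

Definition markov_controls_infty (X0 : Omega -> VX) : set (nat -> Omega -> VU) :=
  [set U | admissible_infty X0 U /\ forall k, markov_at X0 U k].

Definition cost (N : nat) (X0 : Omega -> VX) (U : nat -> Omega -> VU) : R :=
  \sum_(k < N) ell (trajectory U X0 k, U k).

Section turnpike.
Variables (Xs : nat -> Omega -> VX) (Us : nat -> Omega -> VU).

Definition stationary_pair : Prop :=
  [/\ forall k, Xs k.+1 = (fun w => f (Xs k w) (Us k w) (W k w)),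
      markov_controls_infty (Xs 0%N) Us
    & forall j k,
      [/\ eq_on_measurable (law P (Xs j : Omega -> borel VX))
                           (law P (Xs k : Omega -> borel VX)),
          eq_on_measurable (law P (Us j : Omega -> borel VU))
                           (law P (Us k : Omega -> borel VU))
        & eq_on_measurable (law P (joint (Xs j) (Us j)))
                           (law P (joint (Xs k) (Us k)))]].

(* For a stationary pair, ell (Xs k, Us k) and the law of Xs k do not depend
   on k. *)
Definition stationary_cost : R := ell (Xs 0%N, Us 0%N).

Definition stationary_law : probability (borel VX) R :=
  law P (Xs 0%N : Omega -> borel VX).

Definition Lr_turnpike (r : R) : Prop :=
  exists2 alpha : R -> R, class_Kinfty alpha &
  forall X0, state_constraint X0 ->
  exists2 C : R, 0 < C &
  forall (delta : R) (N : nat) (U : nat -> Omega -> VU) (eps : R),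
    0 < delta -> (0 < N)%N -> markov_controls N X0 U ->
    cost N X0 U <= delta + N%:R * stationary_cost -> 0 < eps ->
    N%:R - (delta + C) / alpha eps <=
      #|[pred k : 'I_N.+1 |
          `[< ('E_P[fun w => (`|trajectory U X0 k w - Xs k w| `^ r)%R]
               <= eps%:E)%E >]]|%:R.

Definition distributional_turnpike
    (dD : probability (borel VX) R -> probability (borel VX) R -> \bar R) :
    Prop :=
  exists2 alpha : R -> R, class_Kinfty alpha &
  forall X0, state_constraint X0 ->
  exists2 C : R, 0 < C &
  forall (delta : R) (N : nat) (U : nat -> Omega -> VU) (eps : R),
    0 < delta -> (0 < N)%N -> markov_controls N X0 U ->
    cost N X0 U <= delta + N%:R * stationary_cost -> 0 < eps ->
    N%:R - (delta + C) / alpha eps <=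
      #|[pred k : 'I_N.+1 |
          `[< (dD (law P (trajectory U X0 k : Omega -> borel VX))
                  stationary_law <= eps%:E)%E >]]|%:R.

End turnpike.
End control.

(* Main.v *)
Require Import Defs.
From HB Require Import structures.
From mathcomp Require Import all_boot all_order all_algebra.
From mathcomp Require Import all_classical all_reals all_analysis.
From mathcomp Require Import measurable_realfun.
Import Order.TTheory GRing.Theory Num.Theory.
Import numFieldNormedType.Exports.
Local Open Scope classical_set_scope.
Local Open Scope ring_scope.

(** The states X(k) and X^s(k) live on the same probability space, so the pair
    (X(k), X^s(k)) is itself a coupling of the law of X(k) with the law of
    X^s(k), which is the stationary law. It bounds the Wasserstein distance of
    order s by the L^s distance (wasserstein_le_coupling), which is at most the
    L^r distance because s <= r (lyapunov_inequality). Hence every time k with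
    E |X(k) - X^s(k)|^r <= eps^r is a time at which the Wasserstein distance is
    at most eps, and the turnpike estimate for the tolerance eps^r gives the
    distributional one for the tolerance eps: if alpha_1 is the rate of the
    former, then alpha_3(eps) = alpha_1(eps^r) is a rate for the latter, with
    the same constant C for each initial state. Composition with the r-th power
    preserves the class K_infinity (class_Kinfty_powR).

    Separability of the state space makes |X(k) - X^s(k)| a random variable
    (measurable_normB). *)

(** The Borel sigma-algebra of V * V can be strictly larger than the product
    one, so continuity of the norm of a difference does not suffice. If D is
    dense, then |x - y| < a holds exactly when |x - q| + |y - q| < a for some q
    in D; for a countable D this is a countable union of measurable events. *)
Lemma measurable_normB {R : realType} {V : completeNormedModType R}
    {d : measure_display} {Omega : measurableType d} (X Y : Omega -> V) :
  separable V -> is_random_variable X -> is_random_variable Y ->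
  measurable_fun setT (fun w => `|X w - Y w|).
Proof.
move=> [D cD dD] mX mY.
have mdist (Z : Omega -> V) (q : V) : is_random_variable Z ->
    measurable_fun setT (fun w => `|Z w - q|).
  move=> mZ; apply: (measurability _ (RGenInftyO.measurableE R)).
  move=> _ [_ [a ->] <-].
  suff : measurable (((fun v : V => `|v - q|) @^-1` `]-oo, a[) : set (borel V)).
    by move=> /(mZ measurableT).
  have cdist : continuous (fun v : V => `|v - q|).
    move=> v; apply: (@continuous_comp _ _ _ (fun v => v - q) Num.norm).
      by apply: continuousB => //; exact: cst_continuous.
    exact: norm_continuous.
  apply: sub_sigma_algebra; have /continuousP := cdist.
  by apply; exact: interval_open.
apply: (measurability _ (RGenInftyO.measurableE R)) => _ [_ [a ->] <-].
rewrite setTI.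
have -> : (fun w => `|X w - Y w|) @^-1` `]-oo, a[ =
    \bigcup_(q in D) (fun w => `|X w - q| + `|Y w - q|) @^-1` `]-oo, a[.
  apply/seteqP; split => [w|w [q _]]; rewrite /= !in_itv /=; last first.
    by apply: le_lt_trans; rewrite (distrC (Y w)) ler_distD.
  move=> XYa; pose e := (a - `|X w - Y w|) / 2.
  have e0 : 0 < e by rewrite divr_gt0 // subr_gt0.
  (* Any q within e of X w works: passing through q costs at most 2 e. *)
  have [|q [+ Dq]] := dD (ball (X w) e) _ (ball_open (X w) e).
    by exists (X w); exact: ballxx.
  rewrite -ball_normE /= => Xq.
  exists q => //=; rewrite in_itv /=.
  have Yq : `|Y w - q| <= `|X w - Y w| + `|X w - q|.
    by rewrite (distrC (X w) (Y w)) ler_distD.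
  rewrite (le_lt_trans (lerD (lexx _) Yq))// addrCA -ltrBrDl.
  by rewrite (splitr (a - _)) ltrD.
rewrite bigcup_set_type; apply: countable_bigcupT_measurable => [|q].
  by rewrite (eq_countable (card_setT _)).
rewrite -[X in measurable X]setTI.
by apply: measurable_funD (mdist X _ mX) (mdist Y _ mY) measurableT _ _.
Qed.

(** Hoelder's inequality for Z^s and the constant 1, with exponent r / s on the
    first factor; the norm of the second one is 1 as P is a probability. Both
    sides may be infinite. *)
Lemma lyapunov_inequality {R : realType} {d : measure_display}
    {Omega : measurableType d} (P : probability Omega R) (Z : Omega -> R)
    (s r : R) :
  measurable_fun setT Z -> 0 < s -> s <= r ->
  ('E_P[fun w => (Z w `^ s)%R] `^ s^-1 <=
   'E_P[fun w => (Z w `^ r)%R] `^ r^-1)%E.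
Proof.
move=> mZ s0; rewrite le_eqVlt => /predU1P[<-//|sr].
have r0 : 0 < r by exact: lt_trans sr.
pose p := r / s; pose q := (1 - p^-1)^-1.
have p0 : 0 < p by exact: divr_gt0.
have q0 : 0 < q by rewrite invr_gt0 subr_gt0 invf_div ltr_pdivrMr// mul1r.
have pq : p^-1 + q^-1 = 1 by rewrite invrK subrKC.
have mZs : measurable_fun setT (fun w => Z w `^ s).
  by apply: (@measurableT_comp _ _ _ _ _ _ (@powR R ^~ s)).
have m1 : measurable_fun setT (cst 1 : Omega -> R) by exact: measurable_cst.
have := @hoelder _ _ _ P (fun w => Z w `^ s) (cst 1) p q mZs
  m1 p0 q0 pq.
have -> : (fun w => Z w `^ s) \* cst 1 = (fun w => Z w `^ s) :> (Omega -> R).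
  by apply/funext => w /=; rewrite mulr1.
rewrite Lnorm_cst1 [X in (_ * (X `^ _))%E](probability_setT P) poweR1r mule1 Lnorm1.
under eq_integral do rewrite gee0_abs ?lee_fin ?powR_ge0//.
rewrite !unlock.
under [in X in (_ <= X)%E]eq_integral do
  rewrite gee0_abs ?lee_fin ?powR_ge0// poweR_EFin -powRrM mulrC divfK ?gt_eqF//.
move=> ZsZr.
have int0 (t : R) : (0 <= \int[P]_w (Z w `^ t)%:E)%E.
  by apply: integral_ge0 => w _; rewrite lee_fin powR_ge0.
have -> : r^-1 = p^-1 * s^-1 by rewrite invf_div mulrAC divff ?gt_eqF// mul1r.
rewrite poweRrM gt0_ler_poweR ?invr_ge0 ?(ltW s0)//
  in_itv /= leey ?andbT ?int0 ?poweR_ge0//.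
Qed.

Lemma wasserstein_le_coupling {R : realType} {V : completeNormedModType R}
    {d : measure_display} {Omega : measurableType d} (P : probability Omega R)
    (s : R) (X Y : Omega -> V) (nu : probability (borel V) R) :
  is_random_variable X -> is_random_variable Y ->
  eq_on_measurable (law P (Y : Omega -> borel V)) nu ->
  (wasserstein s (law P (X : Omega -> borel V)) nu <=
   'E_P[fun w => (`|X w - Y w| `^ s)%R] `^ s^-1)%E.
Proof.
by move=> mX mY Ynu; apply: ereal_inf_lbound; exists d, Omega, P, X, Y; split.
Qed.

(** At 0 only one-sided continuity is at hand, for alpha as for the power; the
    two compose because x^r tends to 0 through positive values. *)
Lemma class_Kinfty_powR {R : realType} (alpha : R -> R) (r : R) :
  0 < r -> class_Kinfty alpha -> class_Kinfty (fun x => alpha (x `^ r)).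
Proof.
move=> r0 [/continuous_within_itvcyP[calpha alpha0] inc a0 unb].
have incr : {in `[0, +oo[ &, {homo (@powR R) ^~ r : x y / x < y}}.
  move=> x y; rewrite !in_itv /= !andbT => x0 y0.
  by apply: gt0_ltr_powR; rewrite ?nnegrE.
split.
- apply/continuous_within_itvcyP; split.
    move=> x x0; apply: (@continuous_comp _ _ _ (@powR R ^~ r) alpha).
      by apply/differentiable_continuous/derivable1_diffP/derivable_powR.
    by apply: calpha; move: x0; rewrite !in_itv /= !andbT; exact: powR_gt0.
  rewrite powR0 ?gt_eqF//.
  apply: (@cvg_comp _ _ _ (@powR R ^~ r) alpha _ (0:R)^'+) => //.
  move=> A [e /= e0 eA].
  have /cvgrPdist_lt/(_ _ e0) := powR_cvg0 r0.
  apply: filterS2 (nbhs_right_gt (0 : R)) => x x0 xe.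
  by apply: eA => //; rewrite powR_gt0.
- move=> x y x0 y0 xy; apply: inc; rewrite ?in_itv /= ?powR_ge0 //.
  exact: incr.
- by rewrite powR0 ?gt_eqF.
- move=> M; have [x x0 Mx] := unb M.
  by exists (x `^ r^-1); rewrite ?powR_ge0// -powRrM mulVf ?gt_eqF// powRr1.
Qed.

Theorem mainTheorem4 (R : realType) (VX VU VW : completeNormedModType R)
  (sepX : separable VX) (sepU : separable VU) (sepW : separable VW)
  (d : measure_display) (Omega : measurableType d) (P : probability Omega R)
  (n l : R) (n_ge1 : 1 <= n) (l_ge1 : 1 <= l)
  (W : nat -> Omega -> VW) (rhoW : probability (borel VW) R)
  (iidW : iid P (W : nat -> Omega -> borel VW) rhoW)
  (f : VX -> VU -> VW -> VX)
  (f_cont : {ae rhoW, forall w : VW,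
     continuous (fun xu : (VX * VU)%type => f xu.1 xu.2 w)})
  (YY : set ((Omega -> VX) * (Omega -> VU)))
  (YY_sub : forall X U, YY (X, U) ->
     Lq P n measurable X /\ Lq P l measurable U)
  (YY_law : law_invariant_set P YY)
  (YY_feasible : feasible P l f W YY)
  (ell : (Omega -> VX) * (Omega -> VU) -> R)
  (ell_law : law_invariant_cost P YY ell)
  (r : R) (r_ge1 : 1 <= r) (r_le_n : r <= n)
  (Xs : nat -> Omega -> VX) (Us : nat -> Omega -> VU)
  (stat : stationary_pair P n l f W YY Xs Us) :
  Lr_turnpike P n l f W YY ell Xs Us r ->
  forall s : R, 1 <= s -> s <= r ->
    distributional_turnpike P n l f W YY ell Xs Us (wasserstein s).
Proof.
move=> [alpha Kalpha turnpike] s s1 sr.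
have s0 : 0 < s by exact: lt_le_trans s1.
have r0 : 0 < r by exact: lt_le_trans r_ge1.
exists (fun e => alpha (e `^ r)); first exact: class_Kinfty_powR.
move=> X0 X0X; have [C C0 HC] := turnpike X0 X0X.
exists C => // delta N U e delta0 N0 UF costU e0.
apply: le_trans (HC delta N U (e `^ r) delta0 N0 UF costU (powR_gt0 _ e0)) _.
have YYrv X V : YY (X, V) -> is_random_variable X.
  by move=> /YY_sub[[mX _] _] _ A mA; rewrite setTI; exact: mX.
rewrite ler_nat; apply/subset_leq_card/fintype.subsetP => k.
rewrite !inE => XXs.
have mX : is_random_variable (trajectory f W U X0 k).
  have [[UA [V XNV]] _] := UF.
  have := ltn_ord k; rewrite ltnS leq_eqVlt => /predU1P[->|kN].
    exact: YYrv XNV.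
  by have [_ /YYrv] := UA _ kN.
(* X^s is the trajectory of U^s, hence satisfies the state constraints. *)
have [Xs_rec [Us_adm _] stat_law] := stat.
have XsE j : trajectory f W Us (Xs 0%N) j = Xs j.
  by elim: j => //= j ->; rewrite Xs_rec.
have mXs : is_random_variable (Xs k).
  by have [_ + _] := Us_adm k; rewrite XsE => /YYrv.
have law_Xs : eq_on_measurable (law P (Xs k : Omega -> borel VX))
    (stationary_law P Xs) by have [] := stat_law k 0%N.
apply: le_trans (wasserstein_le_coupling P s _ _ _ mX mXs law_Xs) _.
apply: le_trans (lyapunov_inequality P _ s r (measurable_normB _ _ sepX mX mXs)
  s0 sr) _.
have -> : e%:E = ((e `^ r)%:E `^ r^-1)%E.
  by rewrite poweR_EFin -powRrM divff ?gt_eqF// powRr1 // ltW.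
rewrite gt0_ler_poweR ?invr_ge0 ?(ltW r0)// in_itv /= leey andbT.
  by rewrite unlock; apply: integral_ge0 => w _; rewrite lee_fin powR_ge0.
by rewrite lee_fin powR_ge0.
Qed.
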